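(* Let $T=(V,E)$ be a combinatorial tree with $n=|V|$ nodes and diameter $D$. Then $$D\ge \frac{n-1}{\sum_{i\in V}|2-\mathrm{d}(i)|}.$$
   Context: A tree is a finite, simple, connected, acyclic graph; a combinatorial tree is a tree with all edge weights equal to one. $\mathrm{d}(i)$ is the degree of $i$ (number of incident edges). The diameter is the maximum shortest path distance (number of edges in a shortest path) between any pair of nodes. *)

(* Defs.v *)
(* A simple graph on a finite vertex type [T] is given by its
   adjacency relation [e : rel T], assumed symmetric and irreflexive. *)
From mathcomp Require Import all_boot all_order all_algebra.
Set Implicit Arguments.
Unset Strict Implicit.
Unset Printing Implicit Defensive.

Definition simple_graph (T : finType) (e : rel T) : Prop :=
  symmetric e /\ irreflexive e.

Definition connected_graph (T : finType) (e : rel T) : Prop :=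
  0 < #|T| /\ forall x y : T, connect e x y.

(* [ucycle] also accepts the empty sequence and the back-and-forth [:: x; y]
   along a single edge; a genuine graph cycle has at least 3 vertices. *)
Definition acyclic_graph (T : finType) (e : rel T) : Prop :=
  forall c : seq T, 2 < size c -> ~ ucycle e c.

Definition tree (T : finType) (e : rel T) : Prop :=
  [/\ simple_graph e, connected_graph e & acyclic_graph e].

Definition edges (T : finType) (e : rel T) : {set {set T}} :=
  [set [set p.1; p.2] | p : T * T & e p.1 p.2].

Definition degree (T : finType) (e : rel T) (i : T) : nat :=
  #|[set f in edges e | i \in f]|.

Definition walk_of_length (T : finType) (e : rel T) (x y : T) (k : nat) : bool :=
  [exists p : k.-tuple T, path e x p && (last x p == y)].

(* Least length of a walk from x to y. The search range k < #|T| suffices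
   because shortest walks repeat no vertex; the value is #|T| when y is not
   reachable from x. *)
Definition dist (T : finType) (e : rel T) (x y : T) : nat :=
  find (walk_of_length e x y) (iota 0 #|T|).

Definition diameter (T : finType) (e : rel T) : nat :=
  \max_(x : T) \max_(y : T) dist e x y.

(* Main.v *)
Require Import Defs.
From mathcomp Require Import all_boot all_order all_algebra.
Import Order.TTheory GRing.Theory Num.Theory.
Local Open Scope ring_scope.

(** Every vertex of degree 1 contributes 1 to the sum of the [|2 - d(i)|], so
    this sum is at least the number [l] of leaves and it suffices to show
    [n - 1 <= l * D].

    Root the tree at an arbitrary vertex [r]. A vertex [w] has at most one
    neighbour that is not strictly farther from the root: two such neighbours
    are joined by a walk through [r] that avoids [w], and such a walk closes
    up to a cycle through [w] ([near_neighbour_unique]). Hence every [w <> r]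
    has a well-defined parent, and its branch, the sequence [w, parent w, ...]
    stopped just before [r], has [dist r w <= D] entries. A vertex [v <> r]
    lies on its own branch; among the vertices whose branch contains [v], one
    that is farthest from [r] is a leaf, since any neighbour other than its
    parent would be farther still and its branch would contain [v] too
    ([mem_leaf_branch]). So the branches of the [l] leaves cover the [n - 1]
    vertices other than [r]. *)

Section Walks.
Local Open Scope nat_scope.
Variables (T : finType) (e : rel T).

Lemma walk_of_lengthP x y k :
  reflect (exists p, [/\ path e x p, last x p = y & size p = k])
          (walk_of_length e x y k).
Proof.
apply: (iffP existsP) => [[p /andP[pp /eqP lp]]|[p [pp lp sp]]].
  by exists p; rewrite size_tuple.
have sp' : size p == k by apply/eqP.
by exists (Tuple sp'); rewrite /= pp lp eqxx.
Qed.

Lemma dist_le_size x p : path e x p -> dist e x (last x p) <= size p.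
Proof.
move=> pp; have wp : walk_of_length e x (last x p) (size p).
  by apply/walk_of_lengthP; exists p.
rewrite leqNgt; apply/negP => lt_p.
have p_lt : size p < #|T|.
  by rewrite (leq_trans lt_p) // /dist -[leqRHS](size_iota 0) find_size.
by have := before_find 0 lt_p; rewrite nth_iota // wp.
Qed.

(** Removing the loops of a walk brings its length below [#|T|], hence inside
    the range searched by [dist]. *)
Lemma geodesic_exists x y : connect e x y ->
  exists p, [/\ path e x p, last x p = y & size p = dist e x y].
Proof.
move=> /connectP[p0 pp0 ->]; apply/walk_of_lengthP.
case/shortenP: pp0 => p pp up _.
have has_w : has (walk_of_length e x (last x p)) (iota 0 #|T|).
  apply/hasP; exists (size p); last by apply/walk_of_lengthP; exists p.
  rewrite mem_iota add0n -[(size p).+1]/(size (x :: p)).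
  by rewrite -(card_uniqP up) max_card.
have := nth_find 0 has_w; rewrite nth_iota //.
by rewrite -[ltnRHS](size_iota 0) -has_find.
Qed.

Lemma dist_le_diameter x y : dist e x y <= diameter e.
Proof.
apply: leq_trans (leq_bigmax x).
exact: (leq_bigmax (F := fun y => dist e x y) y).
Qed.

Lemma degree1 w u : symmetric e -> e w u -> (forall v, e w v -> v = u) ->
  degree e w = 1.
Proof.
move=> sym_e ewu uniq_u; rewrite /degree; apply/eqP/cards1P; exists [set w; u].
apply/setP => f; rewrite !inE; apply/andP/eqP => [[/imsetP[[a b] /= eab ->]]|->].
  rewrite inE /= in eab; rewrite !inE => /orP[] /eqP w_ab.
    by move: eab; rewrite -w_ab => /uniq_u ->.
  by move: eab; rewrite -w_ab sym_e => /uniq_u ->; rewrite setUC.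
by split; [apply/imsetP; exists (w, u); rewrite ?inE | rewrite !inE eqxx].
Qed.

End Walks.

Section RootedTree.
Local Open Scope nat_scope.
Variables (T : finType) (e : rel T) (r : T).
Hypothesis treeT : tree e.

Let sym_e : symmetric e. Proof. by case: treeT => -[]. Qed.
Let irr_e : irreflexive e. Proof. by case: treeT => -[]. Qed.
Let conn_e x y : connect e x y. Proof. by case: treeT => _ [_]. Qed.
Let acyc_e : acyclic_graph e. Proof. by case: treeT. Qed.

Let avoid w := [rel x y | [&& e x y, x != w & y != w]].

(** A simple path from [u] to [u'] avoiding [w] closes up to a cycle
    through [w] as soon as it has at least one edge. *)
Lemma neighbours_connect_avoid w u u' :
  e w u -> e w u' -> connect (avoid w) u u' -> u = u'.
Proof.
move=> ewu ewu' /connectP[p0 pp0 def_u'].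
case/shortenP: pp0 def_u' => -[//|y p] pp up _ def_u'; exfalso.
apply: (acyc_e [:: w, u, y & p]) => //.
have w_notin : w \notin y :: p.
  elim: (y :: p) u pp {ewu up def_u'} => //= z s IHs x.
  case/andP=> [/and3P[_ _ zw] /IHs]; by rewrite inE negb_or eq_sym zw.
apply/andP; split; last first.
  rewrite cons_uniq up andbT inE negb_or w_notin andbT.
  by apply: contraTneq ewu => ->; rewrite irr_e.
have pe : path e u (y :: p) by apply: sub_path pp => a b /and3P[].
have -> : cycle e [:: w, u, y & p] = path e w (rcons [:: u, y & p] w) by [].
rewrite rcons_path; apply/andP; split; first by apply/andP.
have -> : last w [:: u, y & p] = u' by rewrite def_u'.
by rewrite sym_e.
Qed.

(** A geodesic from [r] to [u] could only meet [w] at its last vertex. *)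
Lemma connect_avoid_root w u : u != w -> dist e r u <= dist e r w ->
  connect (avoid w) r u.
Proof.
move=> neq_uw le_uw; have [p [pp lp sp]] := geodesic_exists _ _ _ _ (conn_e r u).
have w_notin : w \notin r :: p.
  apply/negP => w_in; case/splitPl: w_in pp lp sp => p1 p2 lp1.
  rewrite cat_path last_cat size_cat => /andP[/dist_le_size] + _.
  rewrite lp1 => le_w lp2 sp.
  have: size p1 + size p2 <= size p1 by rewrite sp (leq_trans le_uw).
  rewrite -[leqRHS]addn0 leq_add2l leqn0 size_eq0 => /eqP p2_nil.
  by rewrite -lp2 p2_nil eqxx in neq_uw.
apply/connectP; exists p => //.
apply: (sub_in_path (P := predC1 w) (e := e)) pp => [a b /= aw bw -> //|].
  by rewrite /avoid /= !inE in aw bw *; rewrite aw bw.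
by apply/allP => a a_in /=; apply: contraNneq w_notin => <-.
Qed.

(** The two neighbours are connected through [r] without meeting [w]. *)
Lemma near_neighbour_unique w u u' : e w u -> e w u' ->
  dist e r u <= dist e r w -> dist e r u' <= dist e r w -> u = u'.
Proof.
have neq_w x : e w x -> x != w by apply: contraTneq => ->; rewrite irr_e.
move=> ewu ewu' le_u le_u'; apply: (neighbours_connect_avoid w) => //.
have avoid_sym : connect_sym (avoid w).
  by apply: sym_connect_sym => x y /=; rewrite sym_e (andbC (x != w)).
apply: connect_trans (connect_avoid_root _ _ (neq_w _ ewu') le_u').
by rewrite avoid_sym connect_avoid_root ?neq_w.
Qed.

Definition parent w : T := odflt r [pick u | e w u && (dist e r u < dist e r w)].

Lemma parentP w : w != r -> e w (parent w) /\ dist e r (parent w) < dist e r w.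
Proof.
move=> neq_wr; rewrite /parent; case: pickP => [u /andP[]//|no_u].
have [p [pp lp sp]] := geodesic_exists _ _ _ _ (conn_e r w).
case/lastP: p => [|p x] in pp lp sp; first by rewrite -lp eqxx in neq_wr.
rewrite rcons_path last_rcons size_rcons in pp lp sp.
have /andP[/dist_le_size le_p] := pp.
by rewrite lp sym_e => ewu; have := no_u (last r p); rewrite ewu -sp ltnS le_p.
Qed.

(** Neighbours of [w] other than its parent are strictly farther from [r];
    this is where the absence of cycles enters the rest of the argument. *)
Lemma parentE w u : w != r -> e w u -> dist e r u <= dist e r w -> u = parent w.
Proof.
move=> /parentP[ewp lt_p] ewu le_u.
exact: near_neighbour_unique ewu ewp le_u (ltnW lt_p).
Qed.

Definition branch w : seq T := traject parent w (dist e r w).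

Lemma mem_branchS w u v : parent u = w -> dist e r w < dist e r u ->
  v \in branch w -> v \in branch u.
Proof.
move=> def_w lt_wu /trajectP[k lt_k ->].
by apply/trajectP; exists k.+1; rewrite ?iterSr ?def_w // (leq_trans _ lt_wu).
Qed.

Lemma dist_gt0 w : w != r -> 0 < dist e r w.
Proof. by move=> /parentP[_]; apply: leq_ltn_trans. Qed.

(** The leaf is a vertex farthest from the root among those whose branch
    passes through [v]. *)
Lemma mem_leaf_branch v : v != r ->
  exists2 w, degree e w == 1 & v \in branch w.
Proof.
move=> neq_vr; pose P w := (w != r) && (v \in branch w).
have Pv : P v.
  by rewrite /P neq_vr; apply/trajectP; exists 0; rewrite ?dist_gt0.
case: (arg_maxnP (fun w => dist e r w) Pv) => w /andP[neq_wr v_in] max_w.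
have [ewp lt_p] := parentP _ neq_wr.
exists w => //; apply/eqP/(degree1 _ _ _ _ sym_e ewp) => u ewu.
apply: parentE => //; rewrite leqNgt; apply/negP => lt_wu.
have neq_ur : u != r.
  (* The empty walk shows that [r] is at distance 0 from itself. *)
  apply: contraTneq lt_wu => ->.
  by rewrite -leqNgt (leq_trans (@dist_le_size _ e r [::] _)).
have def_w : w = parent u by apply: parentE; rewrite // 1?sym_e // ltnW.
have /max_w : P u by rewrite /P neq_ur (mem_branchS w).
by rewrite /geq /= leqNgt lt_wu.
Qed.

(** The branches of the leaves cover all vertices but the root, and a branch
    has at most as many entries as the diameter. *)
Lemma card_le_leaves_diameter :
  #|T|.-1 <= #|[set w | degree e w == 1]| * diameter e.
Proof.
rewrite -(cardsC1 r).
apply: (@leq_trans #|\bigcup_(w | degree e w == 1) [set x in branch w]|).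
  apply/subset_leq_card/subsetP => v; rewrite !inE => /mem_leaf_branch[w w1 v_in].
  by apply/bigcupP; exists w; rewrite ?inE.
apply: (@leq_trans (\sum_(w | degree e w == 1) diameter e)); last first.
  by rewrite sum_nat_const cardsE.
elim/big_ind2: _ => [|m A n B leA leB|w _]; first by rewrite cards0.
  by rewrite (leq_trans (leq_card_setU A B)) ?leq_add.
rewrite cardsE (leq_trans (card_size _)) // size_traject.
exact: dist_le_diameter.
Qed.

End RootedTree.

Theorem theorem1p3 (R : realFieldType) (T : finType) (e : rel T)
  (treeT : tree e) :
  (diameter e)%:R >=
    (#|T|%:R - 1) / (\sum_(i : T) `|2 - (degree e i)%:R|) :> R.
Proof.
have [_ [T_gt0 _] _] := treeT.
have [r _] := card_gt0P T_gt0.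
set S := \sum_i _.
have leaves_le : #|[set w | degree e w == 1%N]|%:R <= S.
  rewrite -sum1_card natr_sum big_mkcond; apply: ler_sum => i _.
  rewrite inE; case: eqP => [->|_]; last exact: normr_ge0.
  by rewrite (_ : 2 - 1 = 1) ?normr1 // -[2]/(1 + 1) addrK.
have S_ge0 : 0 <= S by apply: le_trans leaves_le; rewrite ler0n.
(* Division by 0 yields 0 in a field, which settles a zero sum. *)
have [->|S_neq0] := eqVneq S 0; first by rewrite invr0 mulr0 ler0n.
have -> : #|T|%:R - 1 = #|T|.-1%:R :> R by rewrite -subn1 natrB.
rewrite ler_pdivrMr ?lt_def ?S_neq0 // mulrC.
apply: le_trans (ler_wpM2r (ler0n _ _) leaves_le).
by rewrite -natrM ler_nat card_le_leaves_diameter.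
Qed.
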